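(* There exists a constant $c$ such that the following holds for every natural number $d$ and every real number $\alpha \le \frac{1}{2}$ (with $\alpha>0$). For every natural number $n \ge \alpha^{-cd^2}$, if $G$ is a graph with at least $\alpha^{-cd} n$ vertices and density at least $\alpha$, then $G$ is universal for the family of $d$-degenerate bipartite graphs on $n$ vertices.
   Context: The density of a graph is the fraction of pairs of distinct vertices that form an edge. A graph is $d$-degenerate if every subgraph of it has a vertex of degree at most $d$. A graph $G$ is universal for a family $\mathcal{F}$ of graphs if it contains every $F\in\mathcal{F}$ as a (not necessarily induced) subgraph. *)

(* Defs.v *)
From mathcomp Require Import all_boot all_order all_algebra.
From mathcomp Require Import reals exp.

Set Implicit Arguments.
Unset Strict Implicit.
Unset Printing Implicit Defensive.

Import GRing.Theory Num.Theory.
Local Open Scope ring_scope.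

Record sgraph := SGraph {
  vertex :> finType;
  adj : rel vertex;
  adj_sym : symmetric adj;
  adj_irr : irreflexive adj }.

Definition edges (G : sgraph) : {set {set G}} :=
  [set e | [exists x, exists y, adj x y && (e == [set x; y])]].

Definition degree (G : sgraph) (x : G) : nat := #|[set y : G | adj x y]|.

(* When G has fewer than two vertices this is 0 / 0 = 0. *)
Definition density (R : realType) (G : sgraph) : R :=
  #|edges G|%:R / 'C(#|G|, 2)%:R.

(* Subgraphs are taken up to isomorphism and need not be induced. *)
Definition subgraph (H G : sgraph) : Prop :=
  exists f : H -> G, injective f /\ forall x y : H, adj x y -> adj (f x) (f y).

(* The empty subgraph, which has no vertex at all, is excluded. *)
Definition degenerate (d : nat) (G : sgraph) : Prop :=
  forall H : sgraph, (0 < #|H|)%N -> subgraph H G ->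
  exists x : H, (degree x <= d)%N.

Definition bipartite (G : sgraph) : Prop :=
  exists A : {set G}, forall x y : G, adj x y -> (x \in A) != (y \in A).

Definition universal (G : sgraph) (family : sgraph -> Prop) : Prop :=
  forall F : sgraph, family F -> subgraph F G.

(* Main.v *)
Require Import Defs.
From mathcomp Require Import all_boot all_order all_algebra.
From mathcomp Require Import reals sequences exp.
From mathcomp Require Import ring lra zify.

Set Implicit Arguments.
Unset Strict Implicit.
Unset Printing Implicit Defensive.

Import Order.TTheory GRing.Theory Num.Theory.
Local Open Scope ring_scope.

(** Dependent random choice, applied twice, gives vertex sets [A true] and
[A false] of [G], of size at least [alpha ^ O(d)] times [#|G|], such that for a
uniform [d]-tuple [Q] of one of them the inverse relative codegree of [Q] in the
other one has its moment of order [4d] bounded by [alpha ^ (- O(d^2))].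

The vertices of [F] are embedded in a degeneracy order, each uniformly at random
among the unused common neighbours, on its side, of its at most [d] embedded
neighbours. Let [rho] be the inverse of the proportion of such common
neighbours. The law of each choice has density at most [2 rho] with respect to
the uniform law, so replacing the choices at the back-neighbours of a vertex by
uniform ones bounds the moment of order [2d] of its [rho] by the moments for
uniform tuples and for earlier vertices; by induction [rho] is [alpha ^ (- O(d))]
on average along the whole process. An exponential supermartingale then shows
that the used vertices never fill half of a common neighbourhood, all of which
have at least [sqrt #|G|] elements; so the process never gets stuck. *)

(** * Expectations along a sequence built step by step *)

Section Expectation.
Variables (R : realFieldType) (V : finType).
Implicit Types (k : seq V -> V -> R) (F G : seq V -> R) (s t : seq V).

(** A kernel may depend on the whole history and need not have mass 1, which leaves room for
    reweighted kernels. [F] sees the initial history [s] as well as the [m] new entries. *)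
Fixpoint expect k (m : nat) s F : R :=
  if m is m'.+1 then \sum_v k s v * expect k m' (rcons s v) F else F s.

Definition nonneg k := forall s v, 0 <= k s v.
Definition subprob k := forall s, \sum_v k s v <= 1.

Lemma expect_le k m s F G : nonneg k ->
  (forall t, size t = m -> F (s ++ t) <= G (s ++ t)) ->
  expect k m s F <= expect k m s G.
Proof.
move=> k0; elim: m s => [|m IH] s FG /=; first by rewrite -(cats0 s) FG.
apply: ler_sum => v _; apply: ler_wpM2l; first exact: k0.
by apply: IH => t st; rewrite cat_rcons FG //= st.
Qed.

Lemma eq_expect k m s F G :
  (forall t, size t = m -> F (s ++ t) = G (s ++ t)) ->
  expect k m s F = expect k m s G.
Proof.
elim: m s => [|m IH] s FG /=; first by rewrite -(cats0 s) FG.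
apply: eq_bigr => v _; congr (_ * _).
by apply: IH => t st; rewrite cat_rcons FG //= st.
Qed.

Lemma expect_ge0 k m s F : nonneg k -> (forall t, 0 <= F t) -> 0 <= expect k m s F.
Proof.
move=> k0 F0; elim: m s => [|m IH] s //=.
by apply: sumr_ge0 => v _; apply: mulr_ge0.
Qed.

Lemma expectD k m s F G : expect k m s (fun t => F t + G t) = expect k m s F + expect k m s G.
Proof.
elim: m s => [|m IH] s //=; rewrite -big_split /=.
by apply: eq_bigr => v _; rewrite IH mulrDr.
Qed.

Lemma expectZ k m s c F : expect k m s (fun t => c * F t) = c * expect k m s F.
Proof.
elim: m s => [|m IH] s //=; rewrite mulr_sumr.
by apply: eq_bigr => v _; rewrite IH mulrCA.
Qed.

Lemma expect_sum k m s (I : Type) (r : seq I) (P : pred I) (F : I -> seq V -> R) :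
  expect k m s (fun t => \sum_(i <- r | P i) F i t)
  = \sum_(i <- r | P i) expect k m s (F i).
Proof.
elim: m s => [|m IH] s //=.
under eq_bigr do rewrite IH mulr_sumr.
by rewrite exchange_big.
Qed.

Lemma expect_cst_le k m s c : nonneg k -> subprob k -> 0 <= c ->
  expect k m s (fun=> c) <= c.
Proof.
move=> k0 k1 c0; elim: m s => [|m IH] s //=.
apply: (@le_trans _ _ (\sum_v k s v * c)).
  by apply: ler_sum => v _; apply: ler_wpM2l.
by rewrite -mulr_suml; apply: ler_piMl.
Qed.

Lemma expect_cat k m1 m2 s F :
  expect k (m1 + m2) s F = expect k m1 s (fun t => expect k m2 t F).
Proof.
by elim: m1 s => [|m IH] s //=; apply: eq_bigr => v _; rewrite IH.
Qed.

(** The last [m2] steps have total mass at most 1, so they can be summed out of a function of the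
    prefix. *)
Lemma expect_take_le k m1 m2 s F : nonneg k -> subprob k -> (forall t, 0 <= F t) ->
  expect k (m1 + m2) s (fun t => F (take (size s + m1) t)) <= expect k m1 s F.
Proof.
move=> k0 k1 F0; rewrite expect_cat; apply: expect_le => // t st.
apply: (@le_trans _ _ (expect k m2 (s ++ t) (fun=> F (s ++ t)))); last first.
  exact: expect_cst_le.
by apply: expect_le => // t' _; rewrite take_size_cat // size_cat st.
Qed.

Lemma expect_mono k k' m s F : nonneg k -> (forall s v, k s v <= k' s v) ->
  (forall t, 0 <= F t) -> expect k m s F <= expect k' m s F.
Proof.
move=> k0 kk' F0; elim: m s => [|m IH] s //=.
by apply: ler_sum => v _; apply: ler_pM; rewrite ?expect_ge0.
Qed.

(** Change of measure: the weights met along a path multiply to a likelihood ratio. *)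
Lemma expect_tilt k (w : seq V -> V -> R) v0 m s F :
  expect (fun s v => k s v * w s v) m s F =
  expect k m s (fun t => F t *
    \prod_(size s <= j < size t) w (take j t) (nth v0 t j)).
Proof.
elim: m s => [|m IH] s /=; first by rewrite big_geq // mulr1.
apply: eq_bigr => v _; rewrite IH -mulrA -expectZ; congr (_ * _).
apply: eq_expect => t st; rewrite cat_rcons size_rcons mulrCA.
congr (_ * _); rewrite [RHS]big_ltn; last by rewrite size_cat /= addnS ltnS leq_addr.
by rewrite take_size_cat // nth_cat ltnn subnn.
Qed.

(** Conditional expectations: some step of positive weight keeps the conditional expectation at most
    [c], since otherwise the average would exceed [c]. Mass 1 is asked only of histories that
    satisfy the invariant [ok]. *)
Lemma expect_attained_le k (ok : seq V -> Prop) m s F c : nonneg k ->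
  (forall s, ok s -> \sum_v k s v = 1) ->
  (forall s v, ok s -> 0 < k s v -> ok (rcons s v)) ->
  ok s -> expect k m s F <= c ->
  exists t, [/\ size t = m, ok (s ++ t) & F (s ++ t) <= c].
Proof.
move=> k0 k1 kok; elim: m s => [|m IH] s oks /=.
  by exists [::]; rewrite cats0.
move=> lec.
have [v kv exv] : exists2 v, 0 < k s v & expect k m (rcons s v) F <= c.
  have [/existsP[v /andP[]]|/existsPn H] :=
    boolP [exists v, (0 < k s v) && (expect k m (rcons s v) F <= c)].
    by exists v.
  have [v kv]: exists v, 0 < k s v.
    apply/existsP; apply: contraT => /existsPn H0.
    have := k1 _ oks; rewrite big1 => [/eqP|v _]; first by rewrite eq_sym oner_eq0.
    by apply/eqP; have := H0 v; rewrite lt_def k0 andbT negbK.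
  suff : c < c by rewrite ltxx.
  apply: lt_le_trans lec; rewrite -[ltLHS]mul1r -(k1 _ oks) mulr_suml.
  have ineq u : k s u * c <= k s u * expect k m (rcons s u) F.
    have [->|ku] := eqVneq (k s u) 0; first by rewrite !mul0r.
    have ku0 : 0 < k s u by rewrite lt_def ku k0.
    by apply: ler_wpM2l => //; have := H u; rewrite ku0 /= -ltNge => /ltW.
  rewrite (bigD1 v) //= [ltRHS](bigD1 v) //=; apply: ltr_leD.
    by rewrite ltr_pM2l //; have := H v; rewrite kv /= -ltNge.
  by apply: ler_sum => u _.
have [t [st okt Ft]] := IH _ (kok _ _ oks kv) exv.
by exists (v :: t); rewrite /= st -cat_rcons.
Qed.

End Expectation.

Lemma expect_exchange (R : realFieldType) (V : finType) (k1 k2 : seq V -> V -> R)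
    m1 m2 s1 s2 (F : seq V -> seq V -> R) :
  expect k1 m1 s1 (fun t1 => expect k2 m2 s2 (fun t2 => F t1 t2)) =
  expect k2 m2 s2 (fun t2 => expect k1 m1 s1 (fun t1 => F t1 t2)).
Proof.
elim: m1 s1 => [|m IH] s1 //=.
by rewrite expect_sum; apply: eq_bigr => v _; rewrite IH expectZ.
Qed.

(** * Averages over uniform tuples *)

Section Uniform.
Variables (R : realFieldType) (V : finType).
Implicit Types (A B : {set V}) (F G : seq V -> R) (s t : seq V).

(** The history is a dummy argument that makes this a kernel. On an empty [A] it is zero, so in
    general it is only a subprobability. *)
Definition unif A (s : seq V) (v : V) : R := (v \in A)%:R / #|A|%:R.

Definition avg A m F : R := expect (unif A) m [::] F.

Lemma unif_ge0 A : nonneg (unif A).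
Proof. by move=> s v; rewrite divr_ge0. Qed.

Lemma sum_mem A B : \sum_v (v \in A)%:R * (v \in B)%:R = #|A :&: B|%:R :> R.
Proof.
rewrite -sum1_card natr_sum [RHS]big_mkcond; apply: eq_bigr => v _.
by rewrite -natrM mulnb inE; case: ifP.
Qed.

Lemma sum_unif A s : (0 < #|A|)%N -> \sum_v unif A s v = 1.
Proof.
move=> A0; rewrite /unif -mulr_suml.
have -> : \sum_v (v \in A)%:R = #|A|%:R :> R.
  rewrite -[in RHS](setIT A) -sum_mem.
  by apply: eq_bigr => v _; rewrite inE mulr1.
by rewrite divff // pnatr_eq0 -lt0n.
Qed.

Lemma subprob_unif A : subprob (unif A).
Proof.
move=> s; have [A0|] := ltnP 0 #|A|; first by rewrite sum_unif.
rewrite leqn0 => /eqP A0; rewrite big1 // => v _.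
by rewrite /unif A0 invr0 mulr0.
Qed.

Lemma expect_unif A m s F : expect (unif A) m s F = avg A m (fun t => F (s ++ t)).
Proof.
rewrite /avg -[in LHS](cats0 s).
elim: m [::] => [|m IH] u //=.
apply: eq_bigr => v _; congr (_ * _); rewrite -IH.
by rewrite rcons_cat.
Qed.

Lemma avg0 A F : avg A 0 F = F [::].
Proof. by []. Qed.

Lemma avgS A m F :
  avg A m.+1 F = \sum_v (v \in A)%:R / #|A|%:R * avg A m (fun t => F (v :: t)).
Proof. by rewrite {1}/avg /=; apply: eq_bigr => v _; rewrite expect_unif. Qed.

Lemma avg_cat A m1 m2 F :
  avg A (m1 + m2) F = avg A m1 (fun t1 => avg A m2 (fun t2 => F (t1 ++ t2))).
Proof.
by rewrite /avg expect_cat; apply: eq_expect => t _ /=; rewrite expect_unif.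
Qed.

Lemma avg_le A m F G :
  (forall t, size t = m -> all (mem A) t -> F t <= G t) ->
  avg A m F <= avg A m G.
Proof.
elim: m F G => [|m IH] F G FG; first exact: FG.
rewrite !avgS; apply: ler_sum => v _.
have [vA|] := boolP (v \in A); last by rewrite !mul0r.
rewrite ler_wpM2l ?divr_ge0 //; apply: IH => t st tA.
by apply: FG; rewrite /= ?st ?vA.
Qed.

Lemma eq_avg A m F G :
  (forall t, size t = m -> all (mem A) t -> F t = G t) ->
  avg A m F = avg A m G.
Proof.
by move=> FG; apply/eqP; rewrite eq_le; apply/andP; split;
  apply: avg_le => t st tA; rewrite FG.
Qed.

Lemma avg_cst A m c : (0 < #|A|)%N -> avg A m (fun=> c) = c.
Proof.
move=> A0; elim: m => [//|m IH]; rewrite avgS.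
by rewrite IH -mulr_suml (@sum_unif A [::]) ?mul1r.
Qed.

Lemma avg_ge0 A m F : (forall t, 0 <= F t) -> 0 <= avg A m F.
Proof. by move=> F0; apply: expect_ge0 => //; apply: unif_ge0. Qed.

Lemma avgZ A m c F : avg A m (fun t => c * F t) = c * avg A m F.
Proof. exact: expectZ. Qed.

Lemma avgD A m F G : avg A m (fun t => F t + G t) = avg A m F + avg A m G.
Proof. exact: expectD. Qed.

(** A uniform tuple of [V] conditioned to lie in [A] is uniform in [A]; the power on the left is the
    probability of this event. *)
Lemma avg_restr A m F : (0 < #|A|)%N ->
  (#|A|%:R / #|V|%:R) ^+ m * avg A m F
  = avg setT m (fun t => (all (mem A) t)%:R * F t).
Proof.
move=> A0; elim: m F => [|m IH] F; first by rewrite !avg0 /= !mul1r.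
rewrite !avgS mulr_sumr; apply: eq_bigr => v _.
rewrite inE cardsT mul1r.
have [vA|vA] := boolP (v \in A); last first.
  have -> : avg setT m (fun t => (all (mem A) (v :: t))%:R * F (v :: t)) =
            avg setT m (fun=> 0 * 1).
    by apply: eq_avg => t _ _; rewrite /= (negbTE vA) !mul0r.
  by rewrite avgZ !mul0r !mulr0.
transitivity (#|V|%:R ^-1 * avg setT m (fun t => (all (mem A) t)%:R * F (v :: t))).
  have A1 : #|A|%:R != 0 :> R by rewrite pnatr_eq0 -lt0n.
  rewrite -IH exprS; set x := avg A m _; set y := _ ^+ m.
  by move: x y (#|V|%:R^-1) => x y z; rewrite mulr1n; field.
by congr (_ * _); apply: eq_avg => t _ _; rewrite /= vA.
Qed.

Lemma avg_mem A B m :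
  avg A m (fun t => (all (mem B) t)%:R) = (#|A :&: B|%:R / #|A|%:R) ^+ m.
Proof.
elim: m => [|m IH]; first by rewrite avg0.
rewrite exprS -IH avgS -sum_mem 2!mulr_suml; apply: eq_bigr => v _.
rewrite [_ * _%:R / _]mulrAC -[RHS]mulrA; congr (_ * _); rewrite -avgZ.
by apply: eq_avg => t _ _; rewrite -natrM mulnb.
Qed.

Lemma avg_attained_le A m F c : (0 < #|A|)%N -> avg A m F <= c ->
  exists t, [/\ size t = m, all (mem A) t & F t <= c].
Proof.
move=> A0 le; have [|||t [st okt Ft]] :=
  @expect_attained_le _ _ (unif A) (all (mem A)) m [::] F c (@unif_ge0 A) _ _ _ le => //.
- by move=> s _; apply: sum_unif.
- move=> s v sA; rewrite all_rcons sA andbT /unif /=.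
  by case: (v \in A); rewrite // mul0r ltxx.
- by exists t.
Qed.

(** The single tuple [t] has probability [#|A| ^- m]. This later turns a moment bound into a bound
    for every tuple. *)
Lemma avg_ge_term A m F t : (forall t, 0 <= F t) -> size t = m ->
  all (mem A) t -> F t <= #|A|%:R ^+ m * avg A m F.
Proof.
elim: m F t => [|m IH] F t F0; first by case: t => // _ _; rewrite avg0 mul1r.
case: t => // v t [st] /= /andP[vA tA].
apply: le_trans (IH (fun t => F (v :: t)) _ _ st tA) _ => //.
rewrite exprS -mulrA [leRHS]mulrCA ler_wpM2l ?exprn_ge0 //.
rewrite avgS (bigD1 v) //= vA mul1r mulrDr mulrA mulfV ?mul1r; last first.
  by rewrite pnatr_eq0 -lt0n; apply/card_gt0P; exists v.
rewrite lerDl mulr_ge0 ?sumr_ge0 // => u _.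
by rewrite mulr_ge0 ?divr_ge0 ?avg_ge0.
Qed.

(** Convexity: the left side is the tangent at [c]. Multiplying the induction hypothesis by [x]
    leaves a surplus that is a multiple of [(x - c) ^+ 2]. *)
Lemma tangent_le_pow (x c : R) n : 0 <= x -> 0 <= c ->
  c ^+ n.+1 + n.+1%:R * c ^+ n * (x - c) <= x ^+ n.+1.
Proof.
move=> x0 c0; elim: n => [|n IH]; first by rewrite !expr1 expr0; lra.
rewrite (exprS x); apply: le_trans (ler_wpM2l x0 IH).
rewrite -subr_ge0 (_ : _ - _ = n.+1%:R * c ^+ n * (x - c) ^+ 2).
  by rewrite mulr_ge0 ?sqr_ge0 // mulr_ge0 ?exprn_ge0.
by rewrite -[n.+2%:R]natr1 (exprS c n.+1) (exprS c n); ring.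
Qed.

(** Jensen's inequality, by averaging the tangent at [c]. *)
Lemma avg_pow_ge A m F c n : (0 < #|A|)%N -> (forall t, 0 <= F t) -> 0 <= c ->
  c <= avg A m F -> c ^+ n.+1 <= avg A m (fun t => F t ^+ n.+1).
Proof.
move=> A0 F0 c0 cF.
have /(le_trans _) : avg A m (fun t => c ^+ n.+1 +
    n.+1%:R * c ^+ n * (F t + - c)) <= avg A m (fun t => F t ^+ n.+1).
  by apply: avg_le => t _ _; apply: tangent_le_pow.
apply; rewrite avgD avgZ avgD !avg_cst // lerDl.
by rewrite !mulr_ge0 ?exprn_ge0 ?subr_ge0.
Qed.

End Uniform.

(** * Dependent random choice *)

Section DependentRandomChoice.
Variables (R : realFieldType) (V : finType) (e : rel V).
Hypothesis e_sym : symmetric e.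
Implicit Types (A B : {set V}) (Q T : seq V).

Definition nbr B Q : {set V} := [set v in B | all (e v) Q].

Local Notation cn := (nbr [set: V]).
Local Notation N := (#|V|%:R : R).
Local Notation dens A := (#|A|%:R / N).

(** Both sides say that every entry of [T] is adjacent to every entry of [Q]. *)
Lemma all_nbr T Q : all (mem (cn T)) Q = all (mem (cn Q)) T.
Proof.
transitivity (allrel e Q T).
  by apply: eq_all => v; rewrite /= !inE.
rewrite allrelC; apply: eq_all => v; rewrite /= !inE /=.
by apply: eq_all => u; rewrite e_sym.
Qed.

Lemma nbr_cat T Q : nbr (cn T) Q = cn (T ++ Q).
Proof. by apply/setP => v; rewrite !inE all_cat. Qed.

Lemma nbrE B Q : nbr B Q = B :&: cn Q.
Proof. by apply/setP => v; rewrite !inE. Qed.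

Lemma nbr_sub_catr B Q Q' : nbr B (Q ++ Q') \subset nbr B Q.
Proof.
by apply/subsetP => v; rewrite !inE all_cat => /andP[-> /andP[->]].
Qed.

(** Double counting: both sides are the probability that a random [m]-tuple and a random [k]-tuple
    are completely joined. *)
Lemma avg_dens_sym m k :
  avg setT m (fun T => dens (cn T) ^+ k)
  = avg setT k (fun Q => dens (cn Q) ^+ m).
Proof.
have E j (Q : seq V) : dens (cn Q) ^+ j =
    avg setT j (fun T => (all (mem (cn Q)) T)%:R : R).
  by rewrite avg_mem setTI cardsT.
transitivity (avg setT m (fun T => avg setT k
    (fun Q => (all (mem (cn T)) Q)%:R : R))).
  by apply: eq_avg => T _ _; rewrite E.
rewrite /avg expect_exchange; apply: eq_avg => T _ _; rewrite E.
by apply: eq_avg => Q _ _; rewrite all_nbr.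
Qed.

(** Jensen once for each side of a complete bipartite graph, with [avg_dens_sym] to change sides. *)
Lemma avg_dens_ge (a : R) t D : (0 < #|V|)%N -> 0 <= a ->
  a <= avg setT 1 (fun T => dens (cn T)) ->
  a ^+ (t.+1 * D.+1) <= avg setT t.+1 (fun T => dens (cn T) ^+ D.+1).
Proof.
move=> V0 a0 ha; rewrite exprM; apply: avg_pow_ge; rewrite ?cardsT ?exprn_ge0 //.
  by move=> T; rewrite divr_ge0.
rewrite -[avg _ _ _](_ : avg setT t.+1 (fun T => dens (cn T) ^+ 1) = _) //.
rewrite avg_dens_sym; apply: avg_pow_ge; rewrite ?cardsT //.
by move=> T; rewrite divr_ge0.
Qed.

(* The exponent [m] of the codegree is exactly the number of sampled vertices,
   so the probability that [Q] survives cancels its weight. *)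
Lemma avg_codegree_le1 B m k : (0 < #|B|)%N -> (0 < k)%N ->
  avg B m (fun T => dens (cn T) ^+ k *
    avg (cn T) k (fun Q => (#|B|%:R / #|nbr B Q|%:R) ^+ m)) <= 1.
Proof.
move=> B0 k0; pose h Q : R := (#|B|%:R / #|nbr B Q|%:R) ^+ m.
have h0 Q : 0 <= h Q by rewrite exprn_ge0 ?divr_ge0.
have V0 : (0 < #|V|)%N by apply: leq_trans B0 (max_card _).
apply: (@le_trans _ _ (avg B m (fun T =>
    avg setT k (fun Q => (all (mem (cn T)) Q)%:R * h Q)))).
  apply: avg_le => T _ _; have [T0|] := ltnP 0 #|cn T|; first by rewrite avg_restr.
  rewrite leqn0 => /eqP ->; rewrite mul0r expr0n eqn0Ngt k0 mul0r.
  by apply: avg_ge0 => Q; rewrite mulr_ge0.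
rewrite /avg expect_exchange -[leRHS](@avg_cst _ V setT k) ?cardsT //.
apply: avg_le => Q _ _.
rewrite -/(avg B m _) (_ : avg B m _ =
    h Q * avg B m (fun T => (all (mem (cn Q)) T)%:R)); last first.
  by rewrite -avgZ; apply: eq_avg => T _ _; rewrite mulrC all_nbr.
rewrite avg_mem -nbrE /h -exprMn exprn_ile1 //.
  by rewrite mulr_ge0 ?divr_ge0.
(* Without common neighbours the inverse is 0 by convention, and the product is 0 instead of 1. *)
have [->|Q0] := eqVneq (#|nbr B Q|%:R : R) 0; first by rewrite invr0 mulr0 mul0r.
by rewrite mulrA divfK // divff // pnatr_eq0 -lt0n.
Qed.

(** A random [t]-tuple [T] of vertices gives [A1 = cn T], then a random [t]-tuple [T'] of [A1] gives
    [A2 = cn T']. The first round controls tuples of length [D = t + d], because the common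
    neighbours in [A2] of a [d]-tuple [Q] of [A1] are those of [T' ++ Q] in the whole graph. *)
Lemma exists_balanced_pair (a : R) d : (0 < d)%N -> 0 < a -> a <= 4^-1 ->
  (0 < #|V|)%N -> a <= avg setT 1 (fun T => dens (cn T)) ->
  exists A : bool -> {set V},
  [/\ forall b, a ^+ (6 * d) * N <= #|A b|%:R,
      forall b Q, all (mem (A (~~ b))) Q -> (0 < #|nbr (A b) Q|)%N &
      forall b k, (k <= d)%N ->
        avg (A (~~ b)) k (fun Q => (#|A b|%:R / #|nbr (A b) Q|%:R) ^+ (4 * d))
        <= a^-1 ^+ (24 * d * d)].
Proof.
have tD : (4 * d * (4 * d + d) = 20 * d * d)%N by lia.
have e1 : (6 * d * (4 * d + d) = 4 * d * (4 * d + d) + 10 * d * d)%N by lia.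
have e2 : (6 * d * (4 * d) = 4 * d * (4 * d + d) + 4 * d * d)%N by lia.
move=> d0; have e3 : (6 * d * d + 1 <= 24 * d * d)%N by nia.
have e4 : (20 * d * d + 1 <= 24 * d * d)%N by nia.
move=> a0 a4 V0 ha; set t := (4 * d)%N; set D := (t + d)%N.
have t0 : (0 < t)%N by rewrite muln_gt0.
have D0 : (0 < D)%N by rewrite addn_gt0 t0.
have aX0 n : 0 < a ^+ n by rewrite exprn_gt0.
have a1 : a <= 1 by lra.
have small n : (0 < n)%N -> a ^+ n <= 4^-1.
  by case: n => // n _; apply: le_trans a4; rewrite ler_iXnr // ltW.
have NV : 0 < N by rewrite ltr0n.
pose h Q := N / #|cn Q|%:R.
have h0 Q : 0 <= h Q by rewrite divr_ge0.
(* The first term has average at most [a ^+ (t * D)], the second at most [- 2 * a ^+ (t * D)]. A [T]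
   below the average therefore yields both a large [A1] and a moment of at most
   [2 / a ^+ (t * D)]. *)
have [T [sT _ leT]] : exists T, [/\ size T = t, all (mem [set: V]) T &
  a ^+ (t * D) * (dens (cn T) ^+ D * avg (cn T) D (fun Q => h Q ^+ t)) +
  - 2 * dens (cn T) ^+ D <= - a ^+ (t * D)].
  apply: avg_attained_le; rewrite ?cardsT // avgD !avgZ.
  have := @avg_codegree_le1 setT t D; rewrite cardsT => /(_ V0 D0) le1.
  have ge : a ^+ (t * D) <= avg setT t (fun T => dens (cn T) ^+ D).
    by case: (t) (D) t0 D0 => // t' [//|D'] _ _; apply: avg_dens_ge => //; lra.
  have := ler_wpM2l (ltW (aX0 (t * D)%N)) le1; rewrite mulr1.
  rewrite -/(h _); lra.
set A1 := cn T in leT.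
have A1h0 : 0 <= avg A1 D (fun Q => h Q ^+ t).
  by apply: avg_ge0 => Q; rewrite exprn_ge0.
have x0 : 0 <= dens A1 ^+ D by rewrite exprn_ge0 ?divr_ge0.
have x1 : a ^+ (t * D) <= 2 * dens A1 ^+ D.
  by have := mulr_ge0 (ltW (aX0 (t * D)%N)) (mulr_ge0 x0 A1h0); lra.
have x1p : 0 < dens A1 ^+ D by have := aX0 (t * D)%N; lra.
have A1le : avg A1 D (fun Q => h Q ^+ t) <= 2 / a ^+ (t * D).
  rewrite ler_pdivlMr // -(ler_pM2l x1p).
  move: leT (aX0 (t * D)%N).
  by move: (_ ^+ D) (a ^+ _) (avg _ _ _) => x p y; lra.
have A1p : (0 < #|A1|)%N.
  rewrite lt0n; apply/eqP => A10; move: x1p.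
  by rewrite A10 mul0r expr0n eqn0Ngt D0 ltxx.
set B := 2 / a ^+ (t * D) in A1le.
have B0 : 0 < B by rewrite divr_gt0.
(* Two nonnegative terms of average at most 1 each: the same [T'] keeps both at most 2. *)
have [T' [sT' T'A1 leT']] : exists T', [/\ size T' = t, all (mem A1) T' &
  B^-1 * avg A1 d (fun Q => h (T' ++ Q) ^+ t) + dens (cn T') ^+ d *
  avg (cn T') d (fun Q => (#|A1|%:R / #|nbr A1 Q|%:R) ^+ t) <= 2].
  apply: avg_attained_le => //; rewrite avgD avgZ.
  have -> : avg A1 t (fun T' => avg A1 d (fun Q => h (T' ++ Q) ^+ t)) =
            avg A1 D (fun Q => h Q ^+ t) by rewrite /D avg_cat.
  have := @avg_codegree_le1 A1 t d A1p d0.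
  have : B^-1 * avg A1 D (fun Q => h Q ^+ t) <= 1 by rewrite mulrC ler_pdivrMr ?mul1r.
  lra.
set A2 := cn T' in leT'.
(* The entries of the nonempty tuple [T] are common neighbours of [Q]; for [pos2] those of [T'] are,
   and they lie in [A1]. *)
have pos1 Q : all (mem A1) Q -> (0 < #|cn Q|)%N.
  rewrite /A1 all_nbr => /allP TQ; apply/card_gt0P.
  by case: (T) sT TQ => [|v T1] sT TQ; [rewrite -sT in t0|exists v; apply: TQ; rewrite inE eqxx].
have pos2 Q : all (mem A2) Q -> (0 < #|nbr A1 Q|)%N.
  rewrite /A2 all_nbr => /allP TQ; apply/card_gt0P; rewrite nbrE.
  case: (T') sT' TQ T'A1 => [|v T1] sT1 TQ; first by rewrite -sT1 in t0.
  move=> /andP[vA _]; exists v; rewrite inE; apply/andP; split => //.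
  by apply: TQ; rewrite inE eqxx.
have m1 : avg A1 d (fun Q => h (T' ++ Q) ^+ t) <= 2 * B.
  rewrite -ler_pdivrMr // mulrC; apply: le_trans leT'; rewrite lerDl.
  rewrite mulr_ge0 ?exprn_ge0 ?divr_ge0 //.
  by apply: avg_ge0 => Q; rewrite exprn_ge0 ?divr_ge0.
have m2 : dens A2 ^+ d *
    avg A2 d (fun Q => (#|A1|%:R / #|nbr A1 Q|%:R) ^+ t) <= 2.
  apply: le_trans leT'; rewrite lerDr mulr_ge0 ?invr_ge0 ?(ltW B0) //.
  by apply: avg_ge0 => Q; rewrite exprn_ge0.
have A2p : (0 < #|A2|)%N by apply: pos1.
have hT' : h T' ^+ t <= 2 * B.
  apply: le_trans m1; rewrite -[leLHS](@avg_cst _ _ A1 d) //.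
  apply: avg_le => Q _ QA; rewrite lerXn2r ?nnegrE ?h0 //.
  rewrite ler_pM2l // lef_pV2 ?posrE ?ltr0n ?ler_nat //.
    by apply: subset_leq_card; apply: nbr_sub_catr.
  by apply: pos1; rewrite all_cat T'A1.
(* Otherwise [dens A1 ^+ D] would be below [a ^+ (t * D)] times [a ^+ (10 * d * d)], and the latter
   factor is at most 1/4. *)
have big1 : a ^+ (6 * d) <= dens A1.
  rewrite leNgt; apply/negP => lt.
  have : dens A1 ^+ D < (a ^+ (6 * d)) ^+ D.
    by rewrite ltrXn2r ?nnegrE ?divr_ge0 // ?ltW // -?lt0n // gt_eqF.
  rewrite -exprM [X in a ^+ X]e1 exprD -/t -/D; have := small (10 * d * d)%N; rewrite !muln_gt0 d0 => /(_ isT).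
  have := aX0 (t * D)%N; move: (dens A1 ^+ D) (a ^+ (t * D)) x1 (a ^+ (10 * d * d)).
  by move=> x p xp q p0 q4 xpq; have := ler_wpM2l (ltW p0) q4; lra.
(* [dens A2] is the inverse of [h T'], so [hT'] gives [dens A2 ^+ t] at least [a ^+ (t * D) / 4]. *)
have big2 : a ^+ (6 * d) <= dens A2.
  rewrite leNgt; apply/negP => lt.
  have y0 : 0 < dens A2 by rewrite divr_gt0 ?ltr0n.
  have : dens A2 ^+ t < (a ^+ (6 * d)) ^+ t.
    by rewrite ltrXn2r ?nnegrE ?divr_ge0 // ?ltW // -?lt0n // gt_eqF.
  have : h T' ^+ t * dens A2 ^+ t = 1.
    rewrite -exprMn /h mulrA divfK ?divff ?expr1n //.
      by rewrite gt_eqF.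
    by rewrite pnatr_eq0 -lt0n.
  have : 2 * B * a ^+ (t * D) = 4.
    by rewrite /B; field; rewrite gt_eqF.
  rewrite -exprM [(6 * d * t)%N]e2 exprD -/t -/D; have := small (4 * d * d)%N; rewrite !muln_gt0 d0 => /(_ isT).
  have := aX0 (t * D)%N; have : 0 < dens A2 ^+ t by rewrite exprn_gt0.
  move: (dens A2 ^+ t) (a ^+ (t * D)) (a ^+ (4 * d * d)) (h T' ^+ t) hT' => y p q z.
  move=> zB y1 p0 q4 Bp zy ypq.
  have : 1 <= 2 * B * y by rewrite -[leLHS]zy ler_wpM2r // ltW.
  have : 2 * B * y < 2 * B * (p * q) by rewrite ltr_pM2l // mulr_gt0.
  by rewrite [2 * B * (p * q)]mulrA Bp => lt1 le1; have := le_lt_trans le1 lt1; lra.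
(* Extending a [k]-tuple to a [d]-tuple can only shrink its common neighbourhood. *)
have mono (A A' : {set V}) k : (0 < #|A|)%N -> (k <= d)%N ->
    (forall Q, all (mem A) Q -> (0 < #|nbr A' Q|)%N) ->
    avg A k (fun Q => (#|A'|%:R / #|nbr A' Q|%:R) ^+ t) <=
    avg A d (fun Q => (#|A'|%:R / #|nbr A' Q|%:R) ^+ t) :> R.
  move=> A0 kd posA; rewrite -(subnKC kd) avg_cat.
  apply: avg_le => Q _ QA; rewrite -[leLHS](@avg_cst _ _ A (d - k)) //.
  apply: avg_le => Q' _ QA'; rewrite lerXn2r ?nnegrE ?divr_ge0 //.
  rewrite ler_wpM2l // lef_pV2 ?posrE ?ltr0n ?ler_nat.
  - by apply: subset_leq_card; apply: nbr_sub_catr.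
  - exact: posA.
  - by apply: posA; rewrite all_cat QA.
exists (fun b => if b then A1 else A2); split.
- by case; rewrite -ler_pdivlMr.
- case => Q QA /=; first exact: pos2.
  by rewrite nbr_cat; apply: pos1; rewrite all_cat T'A1.
have ai m n : (m <= n)%N -> a^-1 ^+ m <= a^-1 ^+ n.
  by move=> mn; rewrite ler_weXn2l // invf_ge1.
case => k kd /=.
- apply: le_trans (mono _ _ _ A2p kd pos2) _.
  apply: (@le_trans _ _ (2 * a^-1 ^+ (6 * d * d))).
    rewrite exprM exprVn exprVn ler_pdivlMr ?exprn_gt0 // mulrC.
    apply: le_trans m2; rewrite ler_wpM2r //.
      by apply: avg_ge0 => Q; rewrite exprn_ge0 ?divr_ge0.
    by rewrite lerXn2r ?nnegrE ?divr_ge0 // ltW.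
  apply: le_trans (ai _ _ e3).
  rewrite exprD mulrC ler_pM2l ?exprn_gt0 ?invr_gt0 // expr1.
  by rewrite -[leLHS]invrK lef_pV2 ?posrE ?invr_gt0 //; lra.
- apply: le_trans (mono _ _ _ A1p kd _) _.
    by move=> Q QA; rewrite nbr_cat; apply: pos1; rewrite all_cat T'A1.
  apply: (@le_trans _ _ (2 * B)).
    apply: le_trans m1; apply: avg_le => Q _ QA.
    rewrite nbr_cat lerXn2r ?nnegrE ?divr_ge0 //.
    by rewrite ler_wpM2r ?invr_ge0 // ler_nat max_card.
  rewrite /B tD mulrA -exprVn (_ : 2 * 2 = 4) //; last by lra.
  apply: le_trans (ai _ _ e4).
  rewrite exprD mulrC ler_pM2l ?exprn_gt0 ?invr_gt0 // expr1.
  by rewrite -[leLHS]invrK lef_pV2 ?posrE ?invr_gt0 //; lra.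
Qed.

End DependentRandomChoice.

(** * The random greedy process and the moments of [rho] *)

(** Let [z] be the maximum of 1 and the factors: the product is at most [z ^+ d], and [z ^+ (2 * d)]
    is one of the terms on the right. *)
Lemma prod_sqr_le (R : realFieldType) (I : Type) (r : seq I) (y : I -> R) d :
  (size r <= d)%N -> (forall i, 0 <= y i) ->
  (\prod_(i <- r) y i) ^+ 2 <= 1 + \sum_(i <- r) y i ^+ (2 * d).
Proof.
move=> rd y0.
have [z [z1 zr zs]] : exists z, [/\ 1 <= z, \prod_(i <- r) y i <= z ^+ size r &
    z ^+ (2 * d) <= 1 + \sum_(i <- r) y i ^+ (2 * d)].
  elim: r {rd} => [|i r [z [z1 zr zs]]].
    by exists 1; rewrite !big_nil !expr1n addr0.
  have p0 : 0 <= \prod_(i <- r) y i by apply: prodr_ge0.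
  have q0 : 0 <= \sum_(i <- r) y i ^+ (2 * d).
    by apply: sumr_ge0 => j _; rewrite exprn_ge0.
  rewrite !big_cons /=; have [yz|zy] := leP (y i) z.
    exists z; split=> //; first by rewrite exprS ler_pM.
    by have := exprn_ge0 (2 * d) (y0 i); lra.
  exists (y i); split; [lra| |lra].
  rewrite exprS ler_wpM2l //; apply: le_trans zr _.
  by rewrite lerXn2r ?nnegrE ?y0 //; lra.
apply: le_trans zs; rewrite mulnC exprM lerXn2r ?nnegrE ?prodr_ge0 ?exprn_ge0 //;
  first lra.
by apply: le_trans zr _; rewrite ler_weXn2l.
Qed.

Section RandomGreedyEmbedding.
Variables (R : realType) (V : finType) (e : rel V) (v0 : V).
Variables (A : bool -> {set V}) (d : nat) (mu : R).
Variables (side : nat -> bool) (back : rel nat).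
Hypothesis nbr_gt0 : forall b Q, all (mem (A (~~ b))) Q ->
  (0 < #|nbr e (A b) Q|)%N.
Hypothesis d_gt0 : (0 < d)%N.
Hypothesis mu_ge1 : 1 <= mu.
Hypothesis moment : forall b k, (k <= d)%N ->
  avg (A (~~ b)) k (fun Q => (#|A b|%:R / #|nbr e (A b) Q|%:R) ^+ (4 * d))
  <= mu ^+ (4 * d).
Hypothesis back_side : forall j i, back j i -> side i = ~~ side j.
Hypothesis back_deg : forall j, (count (back j) (iota 0 j) <= d)%N.
Implicit Types (s t Q : seq V) (U P : pred nat).

Definition sel P s := [seq nth v0 s i | i <- iota 0 (size s) & P i].

Definition cand s := nbr e (A (side (size s))) (sel (back (size s)) s).

Definition unused s := cand s :\: [set v in s].

(* The second branch keeps the process going when the used vertices crowd the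
   candidate set; it is shown to be avoidable. *)
Definition target s := if (#|cand s| <= 2 * #|unused s|)%N then unused s else cand s.

(* Positions in [U] ignore the past and are placed uniformly. *)
Definition step U s : V -> R :=
  unif R (if U (size s) then A (side (size s)) else target s) s.

Definition rho s : R := #|A (side (size s))|%:R / #|cand s|%:R.

Lemma step_ge0 U : nonneg (step U).
Proof. by move=> s v; apply: unif_ge0. Qed.

Lemma step_subprob U : subprob (step U).
Proof. by move=> s; apply: subprob_unif. Qed.

Lemma rho_ge0 s : 0 <= rho s.
Proof. by rewrite divr_ge0. Qed.

Lemma target_sub s : target s \subset cand s.
Proof. by rewrite /target; case: ifP => // _; apply: subsetDl. Qed.

Lemma cand_le_target s : (#|cand s| <= 2 * #|target s|)%N.
Proof. by rewrite /target; case: ifP => // _; rewrite leq_pmull. Qed.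

(** [target s] has at least half the size of [cand s], hence the factor 2. *)
Lemma unif_target_le s v :
  unif R (target s) s v <= unif R (A (side (size s))) s v * (2 * rho s).
Proof.
rewrite /unif /rho; have [vK|_] := boolP (v \in target s); last first.
  by rewrite mul0r !mulr_ge0 ?invr_ge0.
have vC := subsetP (target_sub s) _ vK.
have vA : v \in A (side (size s)) by move: vC; rewrite !inE => /andP[].
have K0 : (0 < #|target s|)%N by apply/card_gt0P; exists v.
have C0 : (0 < #|cand s|)%N by apply/card_gt0P; exists v.
have A0 : (0 < #|A (side (size s))|)%N by apply/card_gt0P; exists v.
have := cand_le_target s; rewrite -(ler_nat R) natrM.
move: K0 C0 A0; rewrite vA -!(ltr0n R) !mulr1n.
move: (#|target s|%:R) (#|cand s|%:R) (#|A (side (size s))|%:R) => k c a k0 c0 a0 ck.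
rewrite (_ : 1 / a * _ = 2 / c); last by field; rewrite !gt_eqF.
by rewrite ler_pdivrMr // mulrAC ler_pdivlMr // mul1r.
Qed.

Lemma expect_step_change U U' m (F : seq V -> R) : subpred U U' ->
  (forall t, 0 <= F t) ->
  expect (step U) m [::] F <= expect (step U') m [::] (fun t => F t *
    \prod_(0 <= j < size t | U' j && ~~ U j) (2 * rho (take j t))).
Proof.
move=> UU' F0.
pose w s (_ : V) : R := if U' (size s) && ~~ U (size s) then 2 * rho s else 1.
apply: (@le_trans _ _ (expect (fun s v => step U' s v * w s v) m [::] F)).
  apply: expect_mono => // [|s v]; first exact: step_ge0.
  rewrite /step /w; have [Us|Us] := boolP (U (size s)).
    by rewrite UU' //= mulr1.
  case: ifP => _ /=; last by rewrite mulr1.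
  exact: unif_target_le.
rewrite (expect_tilt _ _ v0); apply: expect_le => [|t _ /=]; first exact: step_ge0.
rewrite [in leRHS]big_mkcond /= ler_wpM2l //.
rewrite le_eqVlt; apply/orP; left; apply/eqP.
rewrite !big_nat; apply: eq_bigr => j /andP[_ jt].
by rewrite /w size_takel // ltnW.
Qed.

Lemma sel_rcons P s v :
  sel P (rcons s v) = if P (size s) then rcons (sel P s) v else sel P s.
Proof.
rewrite /sel size_rcons -addn1 iotaD /= filter_cat map_cat add0n /=.
have -> : [seq nth v0 (rcons s v) i | i <- iota 0 (size s) & P i] = sel P s.
  apply/eq_in_map => i; rewrite mem_filter mem_iota /= => /andP[_ i_s].
  by rewrite nth_rcons i_s.
case: (P _); last by rewrite /= cats0.
by rewrite /= nth_rcons ltnn eqxx cats1.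
Qed.

(** Steps at positions in [P] are uniform whatever happened before, so the selected entries form a
    uniform tuple; the other steps have mass at most 1 and are summed out. *)
Lemma expect_sel_le k (B : {set V}) P m s (F : seq V -> R) :
  nonneg k -> subprob k -> (forall t, 0 <= F t) ->
  (forall s v, P (size s) -> k s v = unif R B s v) ->
  expect k m s (fun t => F (sel P t))
  <= expect (unif R B) (count P (iota (size s) m)) (sel P s) F.
Proof.
move=> k0 k1 F0 kP; elim: m s => [|m IH] s //=.
have [Ps|Ps] := boolP (P (size s)).
  rewrite add1n /=; apply: ler_sum => v _.
  rewrite kP //; apply: ler_wpM2l; first exact: unif_ge0.
  by have := IH (rcons s v); rewrite sel_rcons Ps size_rcons.
rewrite add0n; set c := (leRHS).
have c0 : 0 <= c by apply: expect_ge0 => //; apply: unif_ge0.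
apply: (@le_trans _ _ (\sum_v k s v * c)).
  apply: ler_sum => v _; apply: ler_wpM2l => //.
  by have := IH (rcons s v); rewrite sel_rcons (negbTE Ps) size_rcons.
by rewrite -mulr_suml; apply: ler_piMl.
Qed.

(* Making the back-neighbours of [w] uniform costs the factor [2 rho] at each
   of them; AM-GM separates it from [rho t ^+ (2 * d)], whose square is then an
   average over uniform tuples, while the cost is bounded by induction. *)
Lemma expect_rho_le w U :
  expect (step U) w [::] (fun t => rho t ^+ (2 * d)) <= 8 ^+ d * mu ^+ (4 * d).
Proof.
elim/ltn_ind: w U => w IH U.
pose U' := [pred j | U j || back w j].
have UU' : subpred U U' by move=> j /= ->.
have rX0 n t : 0 <= rho t ^+ n by rewrite exprn_ge0 ?rho_ge0.
apply: le_trans (expect_step_change _ UU' _) _ => //.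
(* [L] is the weight in AM-GM that makes each half at most [M / 2]: [L <= 8 ^+ d] serves the moment
   term, and [1 + 4 ^+ d * (d * M) <= L * M] the induction term. *)
set M := _ * mu ^+ _; pose L : R := d.+1%:R * 4 ^+ d.
have L0 : 0 < L by rewrite mulr_gt0 ?exprn_gt0.
have L8 : L <= 8 ^+ d.
  rewrite /L (_ : (8 : R) = 2 * 4) ?exprMn; last by lra.
  by rewrite ler_wpM2r ?exprn_ge0 // -natrX ler_nat ltn_expl.
have mu0 n : 1 <= mu ^+ n by rewrite exprn_ege1.
have M1 : 1 <= M by rewrite -[leLHS]mul1r ler_pM ?exprn_ege1 //; lra.
pose r := [seq j <- iota 0 w | U' j && ~~ U j].
have rd : (size r <= d)%N.
  apply: leq_trans (back_deg w); rewrite size_filter; apply: sub_count => j /=.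
  by case: (U j); rewrite //= andbT.
have rE (t : seq V) (f : nat -> R) : size t = w ->
    \prod_(0 <= j < size t | U' j && ~~ U j) f j = \prod_(j <- r) f j.
  by move=> tw; rewrite big_filter tw /index_iota subn0.
apply: (@le_trans _ _ (expect (step U') w [::] (fun t => 2^-1 * L * rho t ^+ (4 * d) +
    (2 * L)^-1 * (1 + 4 ^+ d * \sum_(j <- r) rho (take j t) ^+ (2 * d))))).
  apply: expect_le => [|t /= tw]; first exact: step_ge0.
  rewrite rE //.
  have := @prod_sqr_le _ _ r (fun j => 2 * rho (take j t)) d rd.
  move=> /(_ (fun j => mulr_ge0 (ler0n R 2) (rho_ge0 _))).
  rewrite (_ : \sum_(j <- r) _ = 4 ^+ d * \sum_(j <- r) rho (take j t) ^+ (2 * d));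
    last first.
    rewrite mulr_sumr; apply: eq_bigr => j _.
    by rewrite exprMn exprM (_ : 2 ^+ 2 = 4 :> R) // expr2; lra.
  rewrite (_ : 4 * d = 2 * d * 2)%N; last by rewrite mulnAC.
  rewrite [rho t ^+ (2 * d * 2)]exprM.
  move: (rho t ^+ (2 * d)) (\prod_(j <- r) _) (4 ^+ d * _) => x p q pq.
  have : (2 * L)^-1 * (p ^+ 2) <= (2 * L)^-1 * (1 + q).
    by rewrite ler_wpM2l // invr_ge0 mulr_ge0 // ltW.
  rewrite -(lerD2l (2^-1 * L * x ^+ 2)) => /(le_trans _); apply.
  rewrite -subr_ge0.
  rewrite (_ : _ - _ = (2 * L)^-1 * (L * x - p) ^+ 2).
    by rewrite mulr_ge0 ?sqr_ge0 // invr_ge0 mulr_ge0 // ltW.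
  by field; rewrite gt_eqF.
rewrite expectD !expectZ expectD expectZ expect_sum.
have h1 : expect (step U') w [::] (fun t => rho t ^+ (4 * d)) <= mu ^+ (4 * d).
  pose F Q : R := (#|A (side w)|%:R / #|nbr e (A (side w)) Q|%:R) ^+ (4 * d).
  apply: (@le_trans _ _ (expect (step U') w [::] (fun t => F (sel (back w) t)))).
    apply: expect_le => [|t /= tw]; first exact: step_ge0.
    by rewrite /rho /cand tw.
  apply: le_trans (moment (side w) (back_deg w)).
  apply: expect_sel_le.
  - exact: step_ge0.
  - exact: step_subprob.
  - by move=> t; rewrite exprn_ge0 ?divr_ge0.
  - by move=> s v ws; rewrite /step /= ws orbT (back_side ws).
(* The induction hypothesis is needed for the modified process [U']; this is why the lemma holds for
   all [U]. *)
have h2 : \sum_(j <- r) expect (step U') w [::] (fun t => rho (take j t) ^+ (2 * d))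
    <= d%:R * M.
  apply: (@le_trans _ _ (\sum_(j <- r) M)).
    rewrite big_seq [leRHS]big_seq; apply: ler_sum => j.
    rewrite mem_filter mem_iota /= => /andP[_ jw]; apply: le_trans (IH j jw U').
    rewrite -[X in expect _ X](subnKC (ltnW jw)).
    exact: (@expect_take_le _ _ (step U') j (w - j) [::] (fun t => rho t ^+ (2 * d))
      (@step_ge0 _) (@step_subprob _) (rX0 _)).
  by rewrite big_const_seq count_predT iter_addr_0 -[leLHS]mulr_natl ler_wpM2r ?ler_nat //; lra.
have h3 : expect (step U') w [::] (fun=> 1) <= 1.
  by apply: expect_cst_le => //; [exact: step_ge0|exact: step_subprob].
have h4 : L * mu ^+ (4 * d) <= M by rewrite ler_wpM2r //; apply: le_trans (mu0 _).
have h5 : (2 * L)^-1 * (1 + 4 ^+ d * (d%:R * M)) <= 2^-1 * M.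
  rewrite mulrC ler_pdivrMr ?mulr_gt0 ?exprn_gt0 // /L -[d.+1%:R]natr1.
  have : 1 <= 4 ^+ d * M by rewrite -[leLHS]mul1r ler_pM ?exprn_ege1 //; lra.
  by move: (4 ^+ d) (M) (d%:R) => p m q pm; lra.
set x := expect _ _ _ _ in h1 *; set y := \sum_(j <- r) _ in h2 *.
set z := expect _ _ _ _ in h3 *.
have h6 : 2^-1 * L * x <= 2^-1 * L * mu ^+ (4 * d).
  by rewrite ler_wpM2l // mulr_ge0 ?invr_ge0 // ltW.
have h7 : (2 * L)^-1 * (z + 4 ^+ d * y) <= (2 * L)^-1 * (1 + 4 ^+ d * (d%:R * M)).
  apply: ler_wpM2l; first by rewrite invr_ge0 mulr_ge0 // ltW.
  by apply: lerD => //; rewrite ler_wpM2l ?exprn_ge0.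
lra.
Qed.

(** Take expectations in [x <= 1 + x ^+ (2 * d)] at [x = rho / c]. The choice [c = 3 * mu ^+ 2]
    makes [c ^+ (2 * d) = (9 * mu ^+ 4) ^+ d] exceed the bound of [expect_rho_le]. *)
Lemma expect_rho_le6 w : expect (step pred0) w [::] rho <= 6 * mu ^+ 2.
Proof.
pose c := 3 * mu ^+ 2.
have mu2 n : 1 <= mu ^+ n by rewrite exprn_ege1.
have c0 : 0 < c by have := mu2 2; rewrite /c; lra.
apply: (@le_trans _ _ (expect (step pred0) w [::]
    (fun t => c * 1 + c * c^-1 ^+ (2 * d) * rho t ^+ (2 * d)))).
  apply: expect_le => [|t _ /=]; first exact: step_ge0.
  rewrite -mulrA -exprMn -mulrDr -ler_pdivrMl // -[_^-1 * _]/(c^-1 * rho t).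
  have : 0 <= c^-1 * rho t by rewrite mulr_ge0 ?invr_ge0 ?rho_ge0 // ltW.
  move: (c^-1 * rho t) => x x0; have [x1|/ltW x1] := leP x 1.
    by have := exprn_ge0 (2 * d) x0; lra.
  suff : x <= x ^+ (2 * d) by lra.
  by rewrite ler_eXnr // muln_gt0.
rewrite expectD !expectZ; have h1 := expect_rho_le w pred0.
have h2 : expect (step pred0) w [::] (fun=> 1) <= 1.
  by apply: expect_cst_le => //; [exact: step_ge0|exact: step_subprob].
have h3 : c^-1 ^+ (2 * d) * expect (step pred0) w [::] (fun t => rho t ^+ (2 * d)) <= 1.
  rewrite exprVn mulrC ler_pdivrMr ?exprn_gt0 // mul1r; apply: le_trans h1 _.
  rewrite /c !exprM -exprMn lerXn2r ?nnegrE ?sqr_ge0 //.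
    by have := mu2 4%N; lra.
  rewrite exprMn -exprM (_ : 3 ^+ 2 = 9 :> R); last by rewrite expr2; lra.
  by have := mu2 4%N; rewrite (_ : 2 * 2 = 4)%N //; lra.
have := ler_wpM2l (ltW c0) h2; have := ler_wpM2l (ltW c0) h3.
by rewrite mulrA /c; lra.
Qed.

(** * Crowding of common neighbourhoods, and success of the process *)

(** Exponential supermartingale: a step hits [S] with probability at most [p = 2 * #|S| / #|cand|],
    so it multiplies the power of 2 by at most [1 + p] on average, and [1 + p <= expR p]. *)
Lemma expect_crowd_le1 (S : {set V}) m :
  expect (step pred0) m [::] (fun t => 2 ^+ count (mem S) t *
    expR (- (2 * #|S|%:R * \sum_(0 <= j < size t) #|cand (take j t)|%:R^-1))) <= 1.
Proof.
pose g s v : R := (if v \in S then 2 else 1) *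
  expR (- (2 * #|S|%:R * #|cand s|%:R^-1)).
rewrite (_ : expect _ _ _ _ = expect (fun s v => step pred0 s v * g s v) m [::] (fun=> 1)).
  apply: expect_cst_le => // [s v|s].
    by rewrite mulr_ge0 ?step_ge0 // mulr_ge0 ?expR_ge0 //; case: ifP.
  rewrite /g; under eq_bigr do rewrite mulrA; rewrite -mulr_suml.
  rewrite expRN ler_pdivrMr ?expR_gt0 // mul1r; apply: le_trans (expR_ge1Dx _).
  rewrite (_ : \sum_v _ = \sum_v step pred0 s v +
      \sum_v (v \in target s)%:R * (v \in S)%:R / #|target s|%:R); last first.
    rewrite -big_split /=; apply: eq_bigr => v _; rewrite /step /unif /=.
    by case: (v \in S); rewrite ?mulr1n ?mulr0n; ring.
  rewrite lerD ?step_subprob // -mulr_suml sum_mem.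
  (* For an empty [cand s] the inverse is 0, but then [target s] is empty as well. *)
  have [C0|C0] := posnP #|cand s|.
    rewrite C0 (_ : #|_ :&: _| = 0%N) ?mul0r ?invr0 ?mulr0 //.
    apply/eqP; rewrite -leqn0 -C0; apply: subset_leq_card.
    exact: subset_trans (subsetIl _ _) (target_sub s).
  have := cand_le_target s; rewrite -(ler_nat R) natrM => CK.
  have K0 : 0 < #|target s|%:R :> R by move: C0; rewrite -(ltr0n R); lra.
  rewrite ler_pdivrMr //.
  have : #|target s :&: S|%:R <= #|S|%:R :> R.
    by rewrite ler_nat subset_leq_card // subsetIr.
  move=> /le_trans; apply; rewrite mulrAC ler_pdivlMr ?ltr0n //.
  rewrite [leRHS]mulrAC [2 * _ * _]mulrAC [leRHS](_ : _ = #|S|%:R * (2 * #|target s|%:R)).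
    by rewrite ler_wpM2l.
  ring.
rewrite (expect_tilt (step pred0) g v0); apply: eq_expect => t _ /=; rewrite mul1r /g big_split /=.
congr (_ * _); last by rewrite -expR_sum mulr_sumr sumrN.
rewrite -(big_nth v0 predT (fun v => if v \in S then 2 else 1)) /=.
elim: t => [|v t IH]; first by rewrite big_nil.
by rewrite big_cons /= exprD IH; case: (v \in S); rewrite ?expr1 ?expr0.
Qed.

Definition placed t :=
  forall j, (j < size t)%N -> nth v0 t j \in target (take j t).

Lemma all_sel_placed s :
  placed s -> all (mem (A (~~ side (size s)))) (sel (back (size s)) s).
Proof.
move=> ps; apply/allP => v /mapP[i]; rewrite mem_filter mem_iota /=.
move=> /andP[bi i_s] ->; have := subsetP (target_sub _) _ (ps i i_s).
by rewrite inE size_takel ?(ltnW i_s) // (back_side bi) => /andP[].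
Qed.

Lemma placed_rcons s v : placed s -> v \in target s -> placed (rcons s v).
Proof.
move=> ps vs j; rewrite size_rcons ltnS nth_rcons leq_eqVlt => /orP[/eqP ->|js].
  by rewrite ltnn eqxx -cats1 take_size_cat.
by rewrite js -cats1 takel_cat ?(ltnW js) //; apply: ps.
Qed.

Lemma placed_target_gt0 s : placed s -> (0 < #|target s|)%N.
Proof.
move=> /all_sel_placed /nbr_gt0 C0.
by have := leq_trans C0 (cand_le_target s); rewrite muln_gt0.
Qed.

Lemma size_sel P s : size (sel P s) = count P (iota 0 (size s)).
Proof. by rewrite size_map size_filter. Qed.

Lemma expect_inv_cand_le (eta : R) w : 0 < eta ->
  (forall b, eta <= #|A b|%:R) ->
  expect (step pred0) w [::] (fun t => #|cand t|%:R^-1) <= eta^-1 * (6 * mu ^+ 2).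
Proof.
move=> eta0 etaA.
apply: (@le_trans _ _ (expect (step pred0) w [::] (fun t => eta^-1 * rho t))).
  apply: expect_le => [|t _ /=]; first exact: step_ge0.
  rewrite mulrA -[leLHS]mul1r ler_wpM2r ?invr_ge0 //.
  by rewrite mulrC ler_pdivlMr // mul1r.
by rewrite expectZ ler_wpM2l ?invr_ge0 ?expect_rho_le6 // ltW.
Qed.

Lemma greedy_embedding n (eta : R) : 0 < eta ->
  (forall b, eta <= #|A b|%:R) -> 192 * n%:R * mu ^+ 2 <= eta ->
  (forall b Q, (size Q <= d)%N -> all (mem (A (~~ b))) Q ->
    ((4 * (d.+1 * #|V| ^ d)) ^ 4 < 2 ^ #|nbr e (A b) Q|)%N) ->
  exists2 t, size t = n & forall j, (j < n)%N ->
    nth v0 t j \notin take j t /\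
    forall i, (i < j)%N -> back j i -> e (nth v0 t j) (nth v0 t i).
Proof.
move=> eta0 etaA neta large.
(* Indices of all possible candidate sets, for a union bound: a side, a length at most [d], and a
   tuple padded to length [d]. *)
pose I : finType := (bool * 'I_d.+1 * d.-tuple V)%type.
pose S (i : I) := nbr e (A i.1.1) (take i.1.2 i.2).
pose sig t : R := \sum_(0 <= j < size t) #|cand (take j t)|%:R^-1.
pose Z (i : I) t : R := 2 ^+ count (mem (S i)) t * expR (- (2 * #|S i|%:R * sig t)).
have Z0 i t : 0 <= Z i t by rewrite mulr_ge0 ?expR_ge0 ?exprn_ge0.
have cI : (0 < #|I|)%N.
  by apply/card_gt0P; exists (true, ord0, [tuple of nseq d v0]).
have cI' : 0 < #|I|%:R :> R by rewrite ltr0n.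
have cIE : (2 * #|I| = 4 * (d.+1 * #|V| ^ d))%N.
  by rewrite !card_prod card_bool card_ord card_tuple -mulnA mulnA.
have sig_le : expect (step pred0) n [::] sig <= 32^-1.
  rewrite (@eq_expect _ _ _ _ _ _ (fun t => \sum_(0 <= j < n) #|cand (take j t)|%:R^-1));
    last by move=> t <-.
  rewrite expect_sum; apply: (@le_trans _ _ (\sum_(0 <= j < n) eta^-1 * (6 * mu ^+ 2))).
    rewrite big_nat [leRHS]big_nat; apply: ler_sum => j /andP[_ jn].
    apply: le_trans (expect_inv_cand_le j eta0 etaA).
    rewrite -[X in expect _ X](subnKC (ltnW jn)).
    apply: (@expect_take_le _ _ (step pred0) j (n - j) [::]
      (fun t => #|cand t|%:R^-1 : R)).
    - exact: step_ge0.
    - exact: step_subprob.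
    - by move=> t; rewrite invr_ge0.
  rewrite big_const_nat iter_addr_0 subn0 -[leLHS]mulr_natl mulrCA ler_pdivrMl //.
  by move: (n%:R) (mu ^+ 2) neta => x y; lra.
(* Both terms have expectation at most 1. At this [t], [sig t] is at most 1/16 and every [Z i t] at
   most [2 * #|I|]. *)
have [t [tn pt Wt]] : exists t, [/\ size t = n, placed ([::] ++ t) &
    32 * sig t + #|I|%:R^-1 * \sum_i Z i t <= 2].
  apply: (@expect_attained_le _ _ (step pred0) placed n [::]
    (fun t => 32 * sig t + #|I|%:R^-1 * \sum_i Z i t)).
  - exact: step_ge0.
  - by move=> s /placed_target_gt0 K0; apply: sum_unif.
  - move=> s v ps; rewrite /step /unif /=; case: (boolP (v \in _)) => [vs _|_].
      exact: placed_rcons.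
    by rewrite mul0r ltxx.
  - by move=> j.
  - rewrite expectD !expectZ expect_sum.
    have : \sum_i expect (step pred0) n [::] (Z i) <= \sum_(i : I) 1.
      by apply: ler_sum => i _; apply: expect_crowd_le1.
    rewrite sumr_const => h; have : #|I|%:R^-1 *
        \sum_i expect (step pred0) n [::] (Z i) <= 1 by rewrite ler_pdivrMl // mulr1.
    move: (#|I|%:R^-1 * _) sig_le => x y; lra.
have sig0 : 0 <= sig t by apply: sumr_ge0 => j _; rewrite invr_ge0.
have sum0 : 0 <= #|I|%:R^-1 * \sum_i Z i t.
  by rewrite mulr_ge0 ?invr_ge0 // sumr_ge0.
have sigt : sig t <= 16^-1 by lra.
have Zt i : Z i t <= 2 * #|I|%:R.
  have : #|I|%:R^-1 * \sum_i Z i t <= 2 by lra.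
  rewrite mulrC ler_pdivrMr //; apply: le_trans.
  by rewrite (bigD1 i) //= lerDl sumr_ge0.
have e4 : expR (1 : R) <= 4.
  have := expR_ge1Dx (- 2^-1 : R); rewrite expRN.
  have -> : expR (1 : R) = expR 2^-1 ^+ 2.
    by rewrite -expRM_natl; congr expR; lra.
  have x0 := expR_gt0 (2^-1 : R); rewrite -(ler_pM2r x0) mulVf ?gt_eqF //.
  by move: (expR 2^-1) x0 => x x0 x2; rewrite expr2; nra.
(* If more than half of [S i] were used, the eighth power of [2 ^+ count] would exceed
   [2 ^ (4 * #|S i|)]. The bound on [Z i t] allows at most [(2 * #|I|) ^ 8 * 4 ^ #|S i|], which is
   smaller as [(2 * #|I|) ^ 4 < 2 ^ #|S i|]. *)
have uncrowded (i : I) :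
    ((4 * (d.+1 * #|V| ^ d)) ^ 4 < 2 ^ #|S i|)%N -> (2 * count (mem (S i)) t <= #|S i|)%N.
  move=> large_i; rewrite leqNgt; apply/negP => crowd.
  have h1 : 2 ^+ count (mem (S i)) t <= 2 * #|I|%:R * expR (8^-1 * #|S i|%:R) :> R.
    have := Zt i; rewrite /Z expRN ler_pdivrMr ?expR_gt0 // => /le_trans; apply.
    rewrite ler_wpM2l ?mulr_ge0 // ler_expR mulrAC ler_wpM2r //; lra.
  have : (2 ^+ count (mem (S i)) t) ^+ 8 <=
      (2 * #|I|%:R * expR (8^-1 * #|S i|%:R)) ^+ 8 :> R.
    by rewrite lerXn2r ?nnegrE ?exprn_ge0 ?mulr_ge0 ?expR_ge0.
  rewrite exprMn -expRM_natl mulrA (_ : 8%:R * 8^-1 * _ = 1 * #|S i|%:R); last first.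
    by rewrite mulfV ?pnatr_eq0.
  rewrite expRM_natr => h2.
  have h3 : (2 ^+ count (mem (S i)) t) ^+ 8 <= ((2 * #|I|)%:R ^+ 4) ^+ 2 * 4 ^+ #|S i| :> R.
    apply: le_trans h2 _; rewrite -exprM natrM ler_wpM2l ?exprn_ge0 ?mulr_ge0 //.
    by rewrite lerXn2r ?nnegrE ?expR_ge0.
  move: h3; rewrite cIE -!natrX -natrM ler_nat leqNgt => /negP; apply.
  apply: (@leq_trans (((2 ^ #|S i|) ^ 2) * 4 ^ #|S i|)).
    by rewrite ltn_pmul2r ?expn_gt0 // ltn_exp2r.
  rewrite -[4%N]/(2 ^ 2)%N -!expnM -expnD leq_exp2l //.
  by move: (count _ t) #|S i| crowd => x y; clear; lia.
exists t => // j jn; have js : size (take j t) = j by rewrite size_takel // tn ltnW.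
have pj : placed (take j t).
  move=> i; rewrite js => ij; rewrite nth_take // take_takel ?(ltnW ij) //.
  by apply: pt; rewrite tn; apply: ltn_trans ij jn.
set Q := sel (back (size (take j t))) (take j t).
have Qd : (size Q <= d)%N by rewrite size_sel.
have sQ : size (Q ++ nseq (d - size Q) v0) == d by rewrite size_cat size_nseq subnKC.
pose i : I := (side (size (take j t)), Ordinal (Qd : (size Q < d.+1)%N), Tuple sQ).
have Si : S i = cand (take j t) by rewrite /S /= take_size_cat.
have unusedj : target (take j t) = unused (take j t).
  rewrite /target; case: ifP => // /negP[].
  have : (2 * count (mem (S i)) t <= #|S i|)%N.
    by apply: uncrowded; rewrite Si; apply: large => //; apply: all_sel_placed.
  rewrite Si; set C := cand _ => h.
  have : (#|C :&: [set v in take j t]| <= count (mem C) t)%N.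
    apply: (@leq_trans (count (mem C) (take j t))); last first.
      by rewrite -[in leqRHS](cat_take_drop j t) count_cat leq_addr.
    rewrite -size_filter; apply: leq_trans (card_size _).
    apply: subset_leq_card; apply/subsetP => v /setIP[vC].
    by rewrite in_set => vt; rewrite mem_filter vt /= vC.
  have := cardsID [set v in take j t] C; rewrite -/(unused _).
  by move: #|unused _| #|C| #|C :&: _| (count _ t) h => a b c x; clear; lia.
have := pt j; rewrite tn => /(_ jn); rewrite /= unusedj !inE => /andP[-> /andP[_ /allP h]].
split=> // k kj bk; apply: h; apply/mapP; exists k.
  by rewrite mem_filter js bk mem_iota.
by rewrite nth_take.
Qed.

End RandomGreedyEmbedding.

(** * Degeneracy orders *)

(** By induction on [S], a vertex of degree at most [d] in the subgraph induced on [S] goes last. *)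
Lemma degenerate_order (F : sgraph) d : degenerate d F ->
  exists o : seq F, [/\ uniq o, forall x, x \in o &
    forall x0 j, (j < size o)%N ->
      (count (adj (nth x0 o j)) (take j o) <= d)%N].
Proof.
move=> degF.
suff H (S : {set F}) : exists o : seq F, [/\ uniq o, o =i S &
    forall x0 j, (j < size o)%N -> (count (adj (nth x0 o j)) (take j o) <= d)%N].
  have [o [uo oS od]] := H setT; exists o; split=> // x.
  by rewrite oS inE.
have [m] := ubnP #|S|; elim: m S => // m IH S Sm.
have [->|[x0 x0S]] := set_0Vmem S.
  by exists [::]; split=> // x; rewrite !inE.
pose H := @SGraph {x : F | x \in S} (relpre val (@adj F))
  (fun x y => adj_sym _ _) (fun x => adj_irr _).
have [||x xd] := degF H.
- by apply/card_gt0P; exists (exist _ x0 x0S).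
- by exists (val : H -> F); split=> //; apply: val_inj.
have xS : val x \in S := valP x.
have [|o [uo oS od]] := IH (S :\ val x).
  by move: Sm; rewrite (cardsD1 (val x)) xS.
have xo : val x \notin o by rewrite oS !inE eqxx.
exists (rcons o (val x)); split.
- by rewrite rcons_uniq xo.
- by move=> y; rewrite mem_rcons inE oS !inE; case: eqVneq => [->|].
move=> y0 j; rewrite size_rcons ltnS nth_rcons leq_eqVlt => /orP[/eqP ->|js].
  rewrite ltnn eqxx -cats1 take_size_cat //; apply: leq_trans xd.
  rewrite /degree -size_filter -[leqRHS](card_imset _ val_inj).
  rewrite -(card_uniqP (filter_uniq _ uo)); apply: subset_leq_card.
  apply/subsetP => y; rewrite mem_filter oS !inE => /and3P[xy _ yS].
  by apply/imsetP; exists (exist _ y yS : H); rewrite ?inE.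
by rewrite js -cats1 takel_cat ?(ltnW js) //; apply: od.
Qed.

(** * Numerical estimates and average degree *)

Lemma quadratic_lt_exp2 l : (11 <= l)%N -> (8 + 12 * l + 8 * (l * l) < 2 ^ l)%N.
Proof.
elim: l => // l IH; rewrite leq_eqVlt => /orP[/eqP <- //|].
by rewrite ltnS => l11; have := IH l11; rewrite expnS; nia.
Qed.

(** With [l] the integer part of the binary logarithm of [s], both [d <= l] and
    [N <= 2 ^ (2 * l.+1)], so the logarithm of the left side is quadratic in [l], while [s] is at
    least [2 ^ l]. *)
Lemma poly_lt_exp2 d N s : (N <= s ^ 2)%N -> (2 ^ 11 <= s)%N -> (2 ^ d <= s)%N ->
  ((4 * (d.+1 * N ^ d)) ^ 4 < 2 ^ s)%N.
Proof.
move=> Ns s11 sd; have s0 : (0 < s)%N by apply: leq_trans s11.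
have /andP[ls sl] := @trunc_log_bounds 2 s isT s0.
set l := trunc_log 2 s in ls sl.
have dl : (d <= l)%N by rewrite -ltnS -(@ltn_exp2l 2) //; apply: leq_ltn_trans sl.
have l11 : (11 <= l)%N by rewrite -ltnS -(@ltn_exp2l 2) //; apply: leq_ltn_trans sl.
apply: (@leq_ltn_trans (2 ^ (8 + 12 * l + 8 * (l * l)))).
  apply: (@leq_trans ((4 * (2 ^ d * ((2 ^ l.+1) ^ 2) ^ d)) ^ 4)).
    rewrite leq_exp2r // leq_pmul2l //; apply: leq_mul; first exact: ltn_expl.
    have [->//|d0] := posnP d; rewrite leq_exp2r //; apply: leq_trans Ns _.
    by rewrite leq_exp2r // ltnW.
  rewrite -[X in ((X * _) ^ 4)%N]/(2 ^ 2)%N -!expnM -!expnD -expnM leq_exp2l //; nia.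
by rewrite ltn_exp2l //; apply: leq_trans (quadratic_lt_exp2 l11) ls.
Qed.

(** Every edge comes from an ordered adjacent pair, and [#|G| ^ 2] is at most 4 times the number of
    unordered pairs. *)
Lemma avg_degree_ge (R : realType) (G : sgraph) (alpha : R) : (1 < #|G|)%N ->
  alpha <= density R G ->
  alpha / 4 <= avg [set: G] 1 (fun T => #|nbr (@adj G) setT T|%:R / #|G|%:R).
Proof.
move=> G1; set N : R := #|G|%:R.
have N0 : 0 < N by rewrite ltr0n ltnW.
have C0 : (0 < 'C(#|G|, 2))%N by rewrite bin_gt0.
have C4 : N * N <= 4 * 'C(#|G|, 2)%:R.
  have : (#|G| * #|G| <= 4 * 'C(#|G|, 2))%N.
    have := mul_bin_diag #|G| 1; rewrite bin1.
    by move: #|G| ('C(#|G|, 2)) G1 => x y x1 h; nia.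
  by rewrite -(ler_nat R) !natrM.
rewrite /density ler_pdivlMr ?ltr0n // => hE.
have card_edges : (#|edges G| <= \sum_(x : G) #|nbr (@adj G) setT [:: x]|)%N.
  pose E := [set p : G * G | adj p.2 p.1].
  have -> : (\sum_(x : G) #|nbr (@adj G) setT [:: x]| = #|E|)%N.
    rewrite -[RHS]sum1_card (eq_bigl (fun p => adj p.2 p.1)); last first.
      by move=> p; rewrite inE.
    rewrite -(pair_big_dep predT (fun x y => adj y x) (fun _ _ => 1%N)) /=.
    apply: eq_bigr => x _; rewrite -sum1_card; apply: eq_bigl => y.
    by rewrite !inE /= andbT.
  apply: leq_trans (leq_imset_card (fun p => [set p.2; p.1]) E).
  apply: subset_leq_card; apply/subsetP => s; rewrite inE.
  move=> /existsP[x /existsP[y /andP[xy /eqP ->]]].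
  by apply/imsetP; exists (y, x); rewrite ?inE.
rewrite avgS; under eq_bigr do rewrite avg0 inE cardsT mul1r -/N.
rewrite -mulr_sumr -mulr_suml -natr_sum.
have := card_edges; rewrite -(ler_nat R) => hS.
set D : R := (\sum_x _)%:R in hS *.
have -> : N^-1 * (D / N) = D / (N * N) by field; rewrite gt_eqF.
rewrite ler_pdivlMr ?mulr_gt0 //.
have [a0|a0] := leP 0 alpha; last first.
  apply: le_trans (ler0n _ _); rewrite mulr_le0_ge0 ?mulr_ge0 ?ltW //.
  by rewrite pmulr_llt0 // invr_gt0.
have := ler_wpM2l a0 C4; move: hE hS; lra.
Qed.

(** * Choice of parameters and conclusion *)

Lemma degenerate_subgraph (R : realType) (alpha : R) d n (G F : sgraph) :
  (0 < d)%N -> 0 < alpha -> alpha <= 2^-1 -> (0 < n)%N ->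
  alpha^-1 ^+ (200 * d) * n%:R <= #|G|%:R -> alpha <= density R G ->
  #|F| = n -> bipartite F -> degenerate d F -> subgraph F G.
Proof.
move=> d0.
have e18 : (18 * d = 3 * (6 * d))%N by lia.
have e24 : (6 * d * (4 * d) = 24 * d * d)%N by lia.
have e1 : (1 <= 200 * d)%N by lia.
have e144 : (18 * d * 8 <= 200 * d)%N by lia.
have e22 : (11 * 2 <= 200 * d)%N by lia.
have ed : (d * 2 <= 200 * d)%N by lia.
have e62 : (8 + 18 * d * 3 <= 200 * d)%N by lia.
move=> al0 al2 n0 GN dG Fn [X FX] degF.
set b := alpha^-1 in GN; set N : R := #|G|%:R.
have b2 : 2 <= b by rewrite /b -[leLHS]invrK lef_pV2 ?posrE ?invr_gt0.
have n1 : 1 <= n%:R :> R by rewrite ler1n.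
have b0 : 0 < b by rewrite invr_gt0.
have bX m k : (m <= k)%N -> b ^+ m <= b ^+ k.
  by move=> mk; rewrite ler_weXn2l //; lra.
have bN m : (m <= 200 * d)%N -> b ^+ m <= N.
  move=> /bX h; apply: le_trans GN; apply: le_trans h _.
  by rewrite ler_peMr ?exprn_ge0 // ltW.
have pN m : (m <= 200 * d)%N -> (2 ^ m <= #|G|)%N.
  move=> /bN h; rewrite -(ler_nat R); apply: le_trans h.
  by rewrite natrX lerXn2r ?nnegrE // ltW.
have G1 : (1 < #|G|)%N by exact: pN e1.
have [v0 _] : exists v0 : G, true by have /card_gt0P[v] := ltnW G1; exists v.
pose a := alpha / 4.
have a0 : 0 < a by rewrite divr_gt0.
have a4 : a <= 4^-1 by rewrite /a; lra.
have ab : a^-1 <= b ^+ 3.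
  rewrite /a /b invfM invrK !exprS expr0 mulr1 ler_wpM2l ?invr_ge0 ?(ltW al0) //.
  by rewrite -/b; nra.
have N0 : 0 < N by rewrite ltr0n ltnW.
have [A [bigA posA momA]] := exists_balanced_pair (@adj_sym G) d0 a0 a4 (ltnW G1)
  (avg_degree_ge G1 dG).
(* This [mu] serves twice: [mu ^+ (4 * d)] is the moment bound [a^-1 ^+ (24 * d * d)], and [mu^-1]
   the relative size of both sets. *)
have [mu muD] : exists mu, mu = a^-1 ^+ (6 * d) by eexists.
have mu1 : 1 <= mu by rewrite muD exprn_ege1 // invf_ge1 //; lra.
have mu0 : 0 < mu := lt_le_trans ltr01 mu1.
have muE : a ^+ (6 * d) = mu^-1 by rewrite muD exprVn invrK.
have mu_b : mu <= b ^+ (18 * d).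
  by rewrite muD e18 [b ^+ _]exprM lerXn2r ?nnegrE ?exprn_ge0 ?invr_ge0 // ltW.
have momA' c k : (k <= d)%N ->
    avg (A (~~ c)) k (fun Q => (#|A c|%:R / #|nbr (@adj G) (A c) Q|%:R) ^+ (4 * d))
    <= mu ^+ (4 * d).
  by move=> /momA; rewrite muD -exprM e24; apply.
(* With [s] common neighbours, [avg_ge_term] and a [d]-th root give
   [(#|A c| / s) ^+ 4 <= N * mu ^+ 4]. As [#|A c| >= N / mu] and [mu ^+ 8 <= N], it follows that
   [N <= s ^ 2]. *)
have large c Q : (size Q <= d)%N -> all (mem (A (~~ c))) Q ->
    ((4 * (d.+1 * #|G| ^ d)) ^ 4 < 2 ^ #|nbr (@adj G) (A c) Q|)%N.
  move=> Qd QA; set s := #|nbr (@adj G) (A c) Q|.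
  have s0 : 0 < s%:R :> R by rewrite ltr0n posA.
  have h1 : (#|A c|%:R / s%:R) ^+ (4 * d) <= N ^+ d * mu ^+ (4 * d).
    have := @avg_ge_term R _ (A (~~ c)) (size Q)
      (fun Q => (#|A c|%:R / #|nbr (@adj G) (A c) Q|%:R) ^+ (4 * d)) Q.
    move=> /(_ (fun Q => exprn_ge0 _ (divr_ge0 (ler0n _ _) (ler0n _ _))) erefl QA).
    move=> /le_trans; apply; apply: ler_pM; rewrite ?exprn_ge0 ?momA' //.
      by apply: avg_ge0 => Q'; rewrite exprn_ge0 ?divr_ge0.
    apply: (@le_trans _ _ (N ^+ size Q)).
      by rewrite lerXn2r ?nnegrE // ler_nat max_card.
    by rewrite ler_weXn2l // ler1n ltnW.
  have h2 : (#|A c|%:R / s%:R) ^+ 4 <= N * mu ^+ 4.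
    move: h1; rewrite !exprM -exprMn ler_pXn2r ?nnegrE //.
      by rewrite exprn_ge0 ?divr_ge0.
    by rewrite mulr_ge0 ?exprn_ge0 ?(ltW mu0) ?(ltW N0).
  have h3 : (N / (mu * s%:R)) ^+ 4 <= N * mu ^+ 4.
    apply: le_trans h2; rewrite lerXn2r ?nnegrE ?divr_ge0 ?mulr_ge0 ?(ltW mu0) ?(ltW N0) //.
    rewrite invfM mulrA ler_wpM2r ?invr_ge0 //.
    by have := bigA c; rewrite muE mulrC.
  have mu8 : mu ^+ 8 <= N.
    apply: le_trans (bN _ e144).
    by rewrite exprM lerXn2r ?nnegrE ?exprn_ge0 ?(ltW mu0) ?(ltW b0).
  have h4 : N ^+ 2 <= s%:R ^+ 4.
    move: h3; rewrite expr_div_n ler_pdivrMr ?exprn_gt0 ?mulr_gt0 //.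
    rewrite exprMn -mulrA [mu ^+ 4 * _]mulrA -exprD exprS ler_pM2l // => h3.
    rewrite -(ler_pM2l N0) -exprS; apply: le_trans h3 _.
    by rewrite ler_wpM2r ?exprn_ge0.
  have Ns : (#|G| <= s ^ 2)%N.
    by rewrite -(@leq_exp2r _ _ 2) // -expnM -(ler_nat R) !natrX.
  apply: poly_lt_exp2 => //; rewrite -(@leq_exp2r _ _ 2) // -expnM.
    exact: leq_trans (pN _ e22) Ns.
  exact: leq_trans (pN _ ed) Ns.
have eta0 : 0 < mu^-1 * N by rewrite mulr_gt0 // invr_gt0.
have etaA c : mu^-1 * N <= #|A c|%:R by rewrite -muE.
have neta : 192 * n%:R * mu ^+ 2 <= mu^-1 * N.
  rewrite ler_pdivlMl //.
  apply: le_trans GN; rewrite mulrCA mulrAC -exprS ler_wpM2r //.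
  apply: (@le_trans _ _ (b ^+ 8 * (b ^+ (18 * d)) ^+ 3)); last first.
    by rewrite -exprM -exprD; apply: bX.
  apply: ler_pM => //; first by rewrite exprn_ge0 ?(ltW mu0).
    apply: (@le_trans _ _ (2 ^+ 8)); first by rewrite -natrX ler_nat.
    by rewrite lerXn2r ?nnegrE // ltW.
  by rewrite lerXn2r ?nnegrE ?exprn_ge0 ?(ltW mu0) ?(ltW b0).
have [o [uo oF od]] := degenerate_order degF.
have on : size o = n by rewrite -Fn -(card_uniqP uo) (eq_card oF).
have [x0 _] : exists x0 : F, true.
  by move: n0; rewrite -Fn => /card_gt0P[x]; exists x.
pose side j := nth x0 o j \in X.
(* The guard [j < n] keeps positions past the end of [o], where [nth] returns [x0], from having
   back-neighbours. *)
pose back j i := [&& (i < j)%N, (j < n)%N & adj (nth x0 o j) (nth x0 o i)].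
have back_side j i : back j i -> side i = ~~ side j.
  move=> /and3P[_ _ /FX]; rewrite /side.
  by case: (_ \in X); case: (_ \in X).
have back_deg j : (count (back j) (iota 0 j) <= d)%N.
  have [jn|nj] := ltnP j n; last first.
    rewrite (eq_count (a2 := pred0)) ?count_pred0 // => i.
    by rewrite /back [(j < n)%N]ltnNge nj andbF.
  have := od x0 j; rewrite on => /(_ jn); apply: leq_trans.
  rewrite -(map_nth_iota0 x0) ?on ?(ltnW jn) // count_map; apply: sub_count => i.
  by move=> /and3P[].
have [t tn tP] := greedy_embedding v0 posA d0 mu1 momA' back_side back_deg
  eta0 etaA neta large.
have ix x : (index x o < n)%N by rewrite -on index_mem.
exists (fun x => nth v0 t (index x o)); split=> [x y xy|x y xy].
  apply: contra_eq xy => /eqP; wlog lt : x y / (index x o < index y o)%N.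
    move=> H xy; case: (ltngtP (index x o) (index y o)) => [lt|lt|eq].
    - exact: H.
    - by rewrite eq_sym; apply: H => // yx; apply: xy.
    - by case: xy; rewrite -(nth_index x0 (oF x)) eq nth_index.
  move=> _; have [ny _] := tP _ (ix y); apply: contra ny => /eqP <-.
  rewrite -(nth_take v0 lt) mem_nth // size_takel // tn.
  exact: ltnW.
wlog lt : x y xy / (index x o < index y o)%N.
  move=> H; case: (ltngtP (index x o) (index y o)) => [lt|lt|eq].
  - exact: H.
  - by rewrite adj_sym; apply: H => //; rewrite adj_sym.
  - have xE : x = y by rewrite -(nth_index x0 (oF x)) eq nth_index.
    by rewrite xE adj_irr in xy.
have [_ /(_ _ lt)] := tP _ (ix y); rewrite adj_sym; apply.
by rewrite /back lt ix !nth_index // adj_sym.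
Qed.

(** For [d = 0] no vertex has an earlier neighbour in a degeneracy order, so there is no edge and
    any injection works. *)
Lemma edgeless_subgraph (F G : sgraph) :
  (#|F| <= #|G|)%N -> degenerate 0 F -> subgraph F G.
Proof.
move=> FG degF.
have [f [injf _]] : exists f : F -> G, injective f /\ True.
  exists (fun x => enum_val (widen_ord FG (enum_rank x))); split=> // x y.
  by move=> /enum_val_inj /(congr1 val) /= /val_inj /enum_rank_inj.
exists f; split=> // x y xy.
have [o [uo oF od]] := degenerate_order degF.
have ix z : (index z o < size o)%N by rewrite index_mem.
wlog lt : x y xy / (index x o < index y o)%N.
  move=> H; case: (ltngtP (index x o) (index y o)) => [lt|lt|eq].
  - exact: H.
  - by rewrite adj_sym; apply: H => //; rewrite adj_sym.
  - have xE : x = y by rewrite -(nth_index x (oF x)) eq nth_index.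
    by rewrite xE adj_irr in xy.
have := od x _ (ix y); rewrite nth_index // leqn0 -leqn0 leqNgt -has_count.
case/hasP; exists x; last by rewrite adj_sym.
rewrite -[X in X \in _](nth_index x (oF x)) -(nth_take x lt) mem_nth //.
by rewrite size_takel // ltnW.
Qed.

Theorem theorem1p2 (R : realType) :
  exists c : R, forall (d : nat) (alpha : R), 0 < alpha -> alpha <= 1 / 2 ->
  forall n : nat, alpha `^ (- (c * d%:R ^+ 2)) <= n%:R ->
  forall G : sgraph,
    alpha `^ (- (c * d%:R)) * n%:R <= #|G|%:R ->
    alpha <= density R G ->
    universal G (fun F : sgraph => [/\ #|F| = n, bipartite F & degenerate d F]).
Proof.
exists 200 => d alpha al0 al2 n hn G hG dG F [Fn bipF degF].
have n0 : (0 < n)%N by rewrite -(ltr0n R); apply: lt_le_trans hn; apply: powR_gt0.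
have [d0|d0] := posnP d.
  rewrite d0 in degF hG; apply: edgeless_subgraph => //.
  by move: hG; rewrite mulr0 oppr0 powRr0 mul1r ler_nat Fn.
apply: (@degenerate_subgraph R alpha d n) => //; first by lra.
move: hG; rewrite powRN -natrM powR_mulrn ?(ltW al0) //.
by rewrite exprVn.
Qed.
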